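(* Let $n\ge 3$ be an integer and let $P_n=(V,\sigma,\mu)$ be a fuzzy (strong) path with $n$ vertices, represented as $P_n:u_1,u_2,\ldots,u_n$, of size $q$. If $\gamma_{snR}(P_n)=\frac{2}{3}\left(q+\mu_{\min}+\mu_{\max}\right)$ then the following assertions hold: (i) There exist $\ell,\ell^*\in\{1,\ldots,n-1\}$ such that $\mu_{\min}=\mu(u_\ell,u_{\ell+1})$ and $\mu_{\max}=\mu(u_{\ell^*},u_{\ell^*+1})$ and, further, $\{\mu(u_i,u_{i+1})\}_{i=1}^{\ell}$ and $\{\mu(u_i,u_{i+1})\}_{i=\ell^*}^{n-1}$ are non-increasing sequences, and $\{\mu(u_i,u_{i+1})\}_{i=\ell}^{\ell^*}$ is a non-decreasing sequence. (ii) $\mu_s(u_1)=\mu_s(u_2)=\mu_s(u_{n-1})=\mu_s(u_n)=\mu_{\max}$.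
   Context: A fuzzy graph $G=(V,\sigma,\mu)$ consists of a finite nonempty set $V$, a function $\sigma:V\to[0,1]$, and a symmetric function $\mu:V\times V\to[0,1]$ with $\mu(x,x)=0$ and $\mu(x,y)\le \min\{\sigma(x),\sigma(y)\}$ for all $x,y\in V$. An edge is an unordered pair $(u,v)$ of distinct vertices with $\mu(u,v)>0$, and $\mu(u,v)$ is its weight. The size $q$ is the sum of the weights of all edges, each edge counted once. The strength of a path $x_0,x_1,\ldots,x_m$ (with every $\mu(x_{i-1},x_i)>0$) is $\min_i \mu(x_{i-1},x_i)$, and $CONN_G(u,v)$ is the maximum strength of all $u$–$v$ paths. An edge $(u,v)$ is strong if $\mu(u,v)=CONN_G(u,v)$; then $u,v$ are strong neighbors. $N_s(u)$ is the set of strong neighbors of $u$, and $\mu_s(u)=\min\{\mu(u,v):v\in N_s(u)\}$. $\mu_{\min}$ and $\mu_{\max}$ are the minimum and maximum weight of a strong edge. A fuzzy path $P_n:u_1,\ldots,u_n$ is a fuzzy graph with vertex set $V=\{u_1,\ldots,u_n\}$ ($n$ distinct vertices) whose edges are exactly $(u_i,u_{i+1})$ for $1\le i\le n-1$. Every fuzzy path is strong, i.e. all its edges are strong. A strong-neighbors Roman dominating function (SNRDF) on $G$ is a function $f:V\to\{0,1,2\}$ such that every $u$ with $f(u)=0$ has some $v\in N_s(u)$ with $f(v)=2$. Its weight is $w(f)=\sum_{u\in V}f(u)\mu_s(u)$, and $\gamma_{snR}(G)$ is the minimum weight of an SNRDF on $G$. *)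

(* Defs.v *)
From HB Require Import structures.
From mathcomp Require Import all_boot all_order all_algebra.
From mathcomp Require Import classical_sets reals.

Set Implicit Arguments.
Unset Strict Implicit.
Unset Printing Implicit Defensive.

Import Order.TTheory GRing.Theory Num.Theory.
Local Open Scope ring_scope.

Record fuzzyGraph (R : realType) (V : finType) := FuzzyGraph {
  sigma : V -> R;
  mu : V -> V -> R;
  vertex_gt0 : (0 < #|V|)%N;
  sigma_itv : forall x, 0 <= sigma x <= 1;
  mu_itv : forall x y, 0 <= mu x y <= 1;
  mu_sym : forall x y, mu x y = mu y x;
  mu_irr : forall x, mu x x = 0;
  mu_le_sigma : forall x y, mu x y <= Num.min (sigma x) (sigma y)
}.

Section FuzzyGraphTheory.
Context (R : realType) (V : finType).
Implicit Types (G : fuzzyGraph R V) (x y : V) (p : seq V).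

Definition edge G : rel V := fun x y => 0 < mu G x y.

(* Each unordered pair {x, y} is counted once: the ranks of x and y in the
   enumeration of V select one of its two orientations. *)
Definition graph_size G : R :=
  \sum_(e : V * V | edge G e.1 e.2 && (enum_rank e.1 < enum_rank e.2)%N)
    mu G e.1 e.2.

Definition path_between G x y : set (seq V) :=
  [set p | path (edge G) x p && (last x p == y)]%classic.

(* The default value 1 is harmless since weights are at most 1; it is only
   taken by the one-vertex path, which never joins the ends of an edge. *)
Definition strength G x p : R :=
  \big[Num.min/1]_(e <- zip (x :: p) p) mu G e.1 e.2.

(* The supremum is a maximum, see [conn_max]; it is 0 if y is not reachable
   from x. *)
Definition conn G x y : R :=
  sup [set strength G x p | p in path_between G x y]%classic.

Definition strong G : rel V :=
  fun x y => edge G x y && (mu G x y == conn G x y).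

Definition strong_nbr G x : {set V} := [set y | strong G x y].

(* Weights lie in [0, 1], so the default values of the next three extrema
   matter only when there is no strong neighbor, resp. no strong edge. *)
Definition mu_s G x : R := \big[Num.min/1]_(y in strong_nbr G x) mu G x y.

Definition mu_min G : R :=
  \big[Num.min/1]_(e : V * V | strong G e.1 e.2) mu G e.1 e.2.

Definition mu_max G : R :=
  \big[Num.max/0]_(e : V * V | strong G e.1 e.2) mu G e.1 e.2.

Definition SNRDF G (f : {ffun V -> 'I_3}) : bool :=
  [forall x, (f x == 0 :> nat) ==>
     [exists y in strong_nbr G x, f y == 2 :> nat]].

Definition weight G (f : {ffun V -> 'I_3}) : R :=
  \sum_x (f x)%:R * mu_s G x.

(* The default value is the weight of an SNRDF, see [SNRDF_const1]. *)
Definition gamma_snR G : R :=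
  \big[Num.min/weight G [ffun=> inord 1]]_(f | SNRDF G f) weight G f.

(* The vertices are u 1, ..., u n; the other values of u are irrelevant. *)
Definition fuzzy_path G (n : nat) (u : nat -> V) : Prop :=
  [/\ forall i j, (1 <= i <= n)%N -> (1 <= j <= n)%N -> u i = u j -> i = j,
      forall x, exists2 i, (1 <= i <= n)%N & u i = x
    & forall i j, (1 <= i <= n)%N -> (1 <= j <= n)%N ->
        edge G (u i) (u j) = (j == i.+1) || (i == j.+1)].

Lemma strength_val G x p :
  strength G x p \in 1 :: [seq mu G e.1 e.2 | e : V * V].
Proof.
rewrite /strength; elim: (zip _ _) => [|e s IH].
  by rewrite big_nil mem_head.
rewrite big_cons minElt; case: ifP => // _.
by rewrite inE; apply/orP; right; apply/mapP; exists e; rewrite ?mem_enum.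
Qed.

Lemma conn_max G x y :
  (exists p, path_between G x y p) ->
  exists2 p, path_between G x y p & strength G x p = conn G x y /\
    forall q, path_between G x y q -> strength G x q <= strength G x p.
Proof.
have [P Pp] : exists P, P = path_between G x y by exists (path_between G x y).
rewrite -Pp => -[p0 Pp0].
suff [p Qp max_p] : exists2 p, P p &
    forall q, P q -> strength G x q <= strength G x p.
  exists p => //; split=> //; apply/eqP; rewrite eq_le; apply/andP; split.
    apply: ub_le_sup; last by exists p; rewrite -?Pp.
    by exists (strength G x p) => _ [q Pq <-]; apply: max_p; rewrite Pp.
  apply: ge_sup; first by exists (strength G x p), p; rewrite -?Pp.
  by move=> _ [q Pq <-]; apply: max_p; rewrite Pp.
set vals := 1 :: [seq mu G e.1 e.2 | e : V * V].
suff H (k : nat) : forall p, P p ->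
    (count (fun c : R => strength G x p < c)%R vals <= k)%N ->
    exists2 p, P p & forall q, P q -> strength G x q <= strength G x p.
  exact: (H _ p0 Pp0 (leqnn _)).
elim: k => [|k IH] p Qp.
  rewrite leqNgt -has_count => /hasPn no_gt; exists p => // q Qq.
  by rewrite leNgt; apply: no_gt; apply: strength_val.
move=> le_k; have [[q Qq lt_pq]|nex] := boolp.pselect
    (exists2 q, P q & strength G x p < strength G x q); last first.
  exists p => // q Qq; rewrite leNgt; apply/negP => lt_pq.
  by apply: nex; exists q.
apply: (IH q Qq); rewrite -ltnS; apply: leq_trans le_k.
have := strength_val G x q; rewrite -/vals; clear IH.
elim: vals => //= c s IHs; rewrite inE => /orP[/eqP<-|/IHs].
  rewrite ltxx lt_pq add0n add1n ltnS; apply: sub_count => d /=.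
  exact: lt_trans.
move=> lt_s; rewrite -addnS; apply: leq_add => //.
by case: ltP => // lt_qc; rewrite (lt_trans lt_pq lt_qc).
Qed.

Lemma SNRDF_const1 G : SNRDF G [ffun=> inord 1].
Proof. by apply/forallP => x; rewrite ffunE inordK. Qed.

End FuzzyGraphTheory.

Definition nonincreasing_on (R : realType) (a : nat -> R) (m p : nat) : Prop :=
  forall i j, (m <= i)%N -> (i <= j)%N -> (j <= p)%N -> a j <= a i.

Definition nondecreasing_on (R : realType) (a : nat -> R) (m p : nat) : Prop :=
  forall i j, (m <= i)%N -> (i <= j)%N -> (j <= p)%N -> a i <= a j.

(* Main.v *)
(* Write a_i = mu(u_i, u_(i+1)) and b_i = mu_s(u_i), so that b_1 <= a_1,
   b_n <= a_(n-1) and b_i <= min(a_(i-1), a_i) otherwise. The three classes of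
   indices modulo 3 give three SNRDFs; a label 2 at an end of the path may be
   moved to the neighbour of that end, where it costs no more. Adding the three
   weights,
     3 gamma <= b_1 + b_n + 2 (b_2 + ... + b_(n-1)) + 2 b_2 + 2 b_(n-1).
   As 2 min(x, y) = x + y - |x - y|, the hypothesis on gamma turns this into
     2 mu_min + 2 mu_max + T <=
       2 b_2 + 2 b_(n-1) + (b_1 - a_1) + (b_n - a_(n-1)),
   where T is the total variation of (a_i). Passing through a minimum a_l of
   the sequence, T >= a_1 + a_(n-1) - 2 mu_min; hence b_1, b_2, b_(n-1), b_n,
   a_1 and a_(n-1) are all equal to mu_max, and T is exactly
   2 (mu_max - mu_min), so that (a_i) is monotone on each side of l. One can
   therefore take l* = n - 1. *)
Require Import Defs.
From mathcomp Require Import all_boot all_order all_algebra.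
From mathcomp Require Import reals.
From mathcomp Require Import zify lra.

Set Implicit Arguments.
Unset Strict Implicit.
Unset Printing Implicit Defensive.

Import Order.TTheory GRing.Theory Num.Theory.
Local Open Scope ring_scope.

(** * Total variation of a finite sequence *)

Section Valley.
Variables (R : realDomainType) (a : nat -> R).

Definition variation (s t : nat) : R := \sum_(s <= i < t) `|a i.+1 - a i|.

Lemma le_variation s t : (s <= t)%N -> `|a t - a s| <= variation s t.
Proof.
by move=> st; rewrite -telescope_sumr//; apply: ler_norm_sum.
Qed.

Lemma variation_cat t s r :
  (s <= t)%N -> (t <= r)%N -> variation s r = variation s t + variation t r.
Proof. by move=> st tr; rewrite /variation (big_cat_nat st tr). Qed.

Lemma double_sum_min (s t : nat) : (s <= t)%N ->
  \sum_(s <= i < t) 2 * Num.min (a i) (a i.+1) =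
  2 * \sum_(s <= i < t.+1) a i - a s - a t - variation s t.
Proof.
move=> st; rewrite /variation.
have -> : \sum_(s <= i < t) 2 * Num.min (a i) (a i.+1) =
  \sum_(s <= i < t) (a i + a i.+1 - `|a i.+1 - a i|).
  apply: eq_bigr => i _.
  by case: (leP (a i) (a i.+1)) => h; [rewrite ger0_norm|rewrite ltr0_norm]; lra.
rewrite sumrB big_split /= (big_nat_recr t) //=.
have : \sum_(s <= i < t.+1) a i = a s + \sum_(s <= i < t) a i.+1.
  by rewrite big_nat_recl.
rewrite (big_nat_recr t) //=; lra.
Qed.

(** The extremal argument freed from graphs: [N] counts the edges, [M] stands for [mu_max] and [a l]
    for [mu_min]. Bounding each interior [b i.+1] by [Num.min (a i) (a i.+1)] leaves no slack in the
    hypothesis. *)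
Lemma valley (b : nat -> R) (N l : nat) (M : R) : (2 <= N)%N -> (1 <= l <= N)%N ->
  (forall i, (1 <= i <= N)%N -> [/\ a i <= M, b i <= a i & b i.+1 <= a i]) ->
  2 * (\sum_(1 <= i < N.+1) a i + a l + M) <=
    b 1%N + b N.+1 + \sum_(1 <= i < N) 2 * b i.+1 + 2 * b 2%N + 2 * b N ->
  [/\ b 1%N = M, b 2%N = M, b N = M & b N.+1 = M] /\
  [/\ a N = M,
   forall i j, (1 <= i)%N -> (i <= j)%N -> (j <= l)%N -> a j <= a i &
   forall i j, (l <= i)%N -> (i <= j)%N -> (j <= N)%N -> a i <= a j].
Proof.
move=> N2 /andP[l1 lN] ab le_sum.
have le_b : \sum_(1 <= i < N) 2 * b i.+1 <=
    2 * \sum_(1 <= i < N.+1) a i - a 1%N - a N - variation 1 N.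
  rewrite -double_sum_min; last lia.
  rewrite !big_nat; apply: ler_sum => i iN.
  have [|_ _ bi] := ab i; first lia.
  have [|_ bSi _] := ab i.+1; first lia.
  by rewrite ler_wpM2l// le_min bi bSi.
have [|a1M b1a b2a] := ab 1%N; first lia.
have [|aNM bNa bSNa] := ab N; first lia.
have var i j : (i <= j)%N -> a i - a j <= variation i j /\ a j - a i <= variation i j.
  by move=> /le_variation; rewrite ler_norml => /andP[h1 h2]; split; lra.
have var1l := var 1%N l l1; have varlN := var l N lN.
have catl := variation_cat l1 lN.
split; first by split; lra.
split; first lra.
  (* The variation from [1] to [l] is exactly [a 1 - a l]; split at [i] and [j], it leaves no room
     for a rise from [a i] to [a j]. *)
  move=> i j i1 ij jl.
  have := var 1%N i i1; have := var i j ij; have := var j l jl.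
  have := variation_cat i1 (leq_trans ij jl); have := variation_cat ij jl.
  lra.
move=> i j li ij jN.
have := var l i li; have := var i j ij; have := var j N jN.
have := variation_cat li (leq_trans ij jN); have := variation_cat ij jN.
lra.
Qed.
End Valley.

(** * Cuts, strong edges and size of a fuzzy graph *)

Section Graph.
Variables (R : realType) (V : finType).
Implicit Type G : fuzzyGraph R V.

(** A path that leaves [A] uses some edge from [A] to its complement. *)
Lemma strength_cut G (A : pred V) (c : R) :
  (forall x y, edge G x y -> A x -> ~~ A y -> mu G x y <= c) ->
  forall p x, path (edge G) x p -> A x -> ~~ A (last x p) -> strength G x p <= c.
Proof.
move=> Ac; elim=> [|y p IH] x /=; first by move=> _ ->.
case/andP=> exy pyp Ax Al; rewrite /strength big_cons ge_min /=.
have [Ay|nAy] := boolP (A y); last by rewrite Ac.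
by apply/orP; right; apply: IH.
Qed.

(** Every path from [x] to [y] crosses the cut, where no edge outweighs [mu G x y], and the one-edge
    path attains this value. *)
Lemma cut_strong G (A : pred V) x y : edge G x y -> A x -> ~~ A y ->
  (forall x' y', edge G x' y' -> A x' -> ~~ A y' -> mu G x' y' <= mu G x y) ->
  strong G x y.
Proof.
move=> exy Ax Ay cutA; rewrite /strong exy eq_le /=.
have [|p /andP[xp /eqP lp] [<- maxp]] := @conn_max _ _ G x y.
  by exists [:: y]; rewrite /path_between /= exy eqxx.
rewrite (strength_cut cutA) ?lp // andbT.
have -> : mu G x y = strength G x [:: y].
  rewrite /strength /= big_cons big_nil; apply/esym/min_idPl.
  by case/andP: (mu_itv G x y).
by apply: maxp; rewrite /path_between /= exy eqxx.
Qed.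

(** The size orients edges by [enum_rank], unrelated to the order along a path; a sum over ordered
    pairs is free of that choice. *)
Lemma double_size G : 2 * graph_size G = \sum_x \sum_y mu G x y.
Proof.
have sizeE : graph_size G =
    \sum_x \sum_(y | (enum_rank x < enum_rank y)%N) mu G x y.
  rewrite pair_big_dep /= /graph_size big_mkcondl /=; apply: eq_bigr => -[x y] _ /=.
  rewrite /edge; case: ltP => // h; apply/esym/le_anti.
  by rewrite h; case/andP: (mu_itv G x y).
rewrite mulr_natl mulr2n {2}sizeE (exchange_big_dep xpredT) //= sizeE -big_split /=.
apply: eq_bigr => x _; rewrite [RHS](bigID (fun y => enum_rank x < enum_rank y)%N) /=.
congr (_ + _); rewrite [RHS](bigD1 x) /= ?ltnn // mu_irr add0r.
apply: eq_big => [y|y _]; last exact: mu_sym.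
by rewrite -leqNgt ltn_neqAle andbC (inj_eq val_inj) (inj_eq enum_rank_inj).
Qed.

Lemma mu_s_ge0 G x : 0 <= mu_s G x.
Proof.
by apply/bigmin_geP; split=> // y _; case/andP: (mu_itv G x y).
Qed.
End Graph.

(** * Strong edges, size and extremal weights of a fuzzy path *)

Section FuzzyPath.
Variables (R : realType) (V : finType) (G : fuzzyGraph R V) (n : nat) (u : nat -> V).
Hypothesis pathG : fuzzy_path G n u.

Local Notation a i := (mu G (u i) (u i.+1)).
Local Notation b i := (mu_s G (u i)).

Lemma fuzzy_path_pos : exists pos : V -> nat,
  (forall x, (1 <= pos x <= n)%N /\ u (pos x) = x) /\
  forall i, (1 <= i <= n)%N -> pos (u i) = i.
Proof.
have [inj_u surj_u _] := pathG.
have [|pos posP] := @fin_all_exists V (fun=> nat)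
    (fun x i => (1 <= i <= n)%N /\ u i = x).
  by move=> x; have [i] := surj_u x; exists i.
exists pos; split=> // i iP; have [? ?] := posP (u i); exact: inj_u.
Qed.

Lemma fuzzy_path_sum (F : V -> R) :
  \sum_x F x = \sum_(1 <= i < n.+1) F (u i).
Proof.
have [inj_u surj_u _] := pathG.
rewrite -(big_map u xpredT F); apply: perm_big; apply: uniq_perm.
- exact: index_enum_uniq.
- rewrite map_inj_in_uniq ?iota_uniq // => i j.
  by rewrite !mem_index_iota !ltnS; apply: inj_u.
move=> x; rewrite mem_index_enum; apply/esym/mapP.
by have [i iP <-] := surj_u x; exists i; rewrite // mem_index_iota ltnS.
Qed.

Lemma fuzzy_path_edge i : (1 <= i < n)%N -> edge G (u i) (u i.+1).
Proof. by have [_ _ edgeP] := pathG => iP; rewrite edgeP ?eqxx //; lia. Qed.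

(** The vertices on one side of an edge of the path form a cut that this edge alone crosses. *)
Lemma fuzzy_path_strong x y : edge G x y -> strong G x y.
Proof.
have [pos [posP posK]] := fuzzy_path_pos; have [_ _ edgeP] := pathG.
have edge_pos x' y' : edge G x' y' = (pos y' == (pos x').+1) || (pos x' == (pos y').+1).
  have [xP xK] := posP x'; have [yP yK] := posP y'.
  by rewrite -edgeP // xK yK.
move=> exy; have := exy; rewrite edge_pos => /orP[]/eqP pxy.
  apply: (@cut_strong _ _ G (fun z => pos z <= pos x)%N) => //; first lia.
  move=> x' y' + /= lex ley; rewrite edge_pos => exy'.
  have [_ <-] := posP x'; have [_ <-] := posP y'.
  have [_ <-] := posP x; have [_ <-] := posP y.
  have -> : pos x' = pos x by lia.
  by have -> : pos y' = pos y by lia.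
apply: (@cut_strong _ _ G (fun z => pos x <= pos z)%N) => //; first lia.
move=> x' y' + /= lex ley; rewrite edge_pos => exy'.
have [_ <-] := posP x'; have [_ <-] := posP y'.
have [_ <-] := posP x; have [_ <-] := posP y.
have -> : pos x' = pos x by lia.
by have -> : pos y' = pos y by lia.
Qed.

Lemma fuzzy_path_mu_s i : (1 <= i < n)%N -> b i <= a i /\ b i.+1 <= a i.
Proof.
move=> iP; have e := fuzzy_path_edge iP; split.
  by apply: bigmin_le_cond; rewrite inE fuzzy_path_strong.
rewrite mu_sym; apply: bigmin_le_cond; rewrite inE fuzzy_path_strong //.
by rewrite /edge mu_sym.
Qed.

Lemma fuzzy_path_mu_max i : (1 <= i < n)%N -> a i <= mu_max G.
Proof.
move=> iP; apply: (@le_bigmax_cond _ _ _ _ (u i, u i.+1) _ (fun e => mu G e.1 e.2)).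
by rewrite fuzzy_path_strong // fuzzy_path_edge.
Qed.

Hypothesis n_ge3 : (3 <= n)%N.

Lemma fuzzy_path_size : graph_size G = \sum_(1 <= i < n) a i.
Proof.
have [_ _ edgeP] := pathG.
have muE i j : (1 <= i < n.+1)%N -> (1 <= j < n.+1)%N ->
    mu G (u i) (u j) = (if j == i.+1 then a i else 0) + (if i == j.+1 then a j else 0).
  move=> iP jP; case: (eqVneq j i.+1) => [->|ji].
    by rewrite ifN ?addr0 //; lia.
  case: (eqVneq i j.+1) => [->|ij]; first by rewrite add0r mu_sym.
  rewrite addr0; apply/le_anti; case/andP: (mu_itv G (u i) (u j)) => -> _.
  by rewrite andbT leNgt -/(edge G (u i) (u j)) edgeP // negb_or ji ij.
have diag : \sum_(1 <= i < n.+1) \sum_(1 <= j < n.+1) (if j == i.+1 then a i else 0) =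
    \sum_(1 <= i < n) a i.
  rewrite big_nat_recr /=; last lia.
  (* The row [i = n] vanishes: its only candidate [j = n.+1] is out of range. *)
  rewrite [X in _ + X]big_nat_cond [X in _ + X]big1 ?addr0; last first.
    by move=> j jP; rewrite ifN //; lia.
  apply: eq_big_nat => i iP; rewrite -big_mkcond big_nat1_eq ifT //; lia.
apply: (@mulfI _ 2); first by rewrite pnatr_eq0.
rewrite double_size fuzzy_path_sum.
under eq_big_nat => i iP.
  rewrite fuzzy_path_sum.
  under eq_big_nat => j jP do rewrite muE //.
  rewrite big_split; over.
rewrite big_split /= diag exchange_big /= diag mulr_natl; lra.
Qed.

Lemma fuzzy_path_mu_min : exists2 l, (1 <= l < n)%N & mu_min G = a l.
Proof.
have [pos [posP _]] := fuzzy_path_pos; have [_ _ edgeP] := pathG.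
(* The default 1 bounds all weights and the first edge is strong, so the minimum is attained at a
   strong edge. *)
have [|e _|[x y]] := @eq_bigmin _ R _ 1 (u 1%N, u 2%N)
    (fun e => strong G e.1 e.2) (fun e => mu G e.1 e.2).
- by rewrite fuzzy_path_strong // fuzzy_path_edge //; lia.
- by case/andP: (mu_itv G e.1 e.2).
rewrite /in_mem /= => /andP[exy _] minE; rewrite /mu_min minE /=.
have [xP xK] := posP x; have [yP yK] := posP y.
have := exy; rewrite -xK -yK edgeP // => /orP[]/eqP pE.
  by exists (pos x); rewrite ?pE //; lia.
by exists (pos y); rewrite ?pE 1?mu_sym //; lia.
Qed.

(** * Three Roman dominating labelings of a path *)

(* The class of k modulo 3, where a label 2 at an end of the path is moved to
   the neighbour of that end, and an undominated end gets the label 1. *)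
Definition roman_label (k i : nat) : nat :=
  (if i == 1 then nat_of_bool (k %% 3 == 0)
   else if i == n then nat_of_bool (k %% 3 == n.+1 %% 3)
   else if [|| k %% 3 == i %% 3, (i == 2) && (k %% 3 == 1)
             | (i == n.-1) && (k %% 3 == n %% 3)] then 2 else 0)%N.

Lemma roman_label_lt3 k i : (roman_label k i < 3)%N.
Proof.
rewrite /roman_label; do 2?[case: ifP => _; first by case: eqP].
by case: ifP.
Qed.

Lemma roman_label_eq2 k i : (1 < i < n)%N ->
  [|| k %% 3 == i %% 3, (i == 2) && (k %% 3 == 1)
    | (i == n.-1) && (k %% 3 == n %% 3)]%N ->
  roman_label k i = 2%N.
Proof.
move=> iP kP; rewrite /roman_label ifN; last lia.
by rewrite ifN ?kP //; lia.
Qed.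

Lemma roman_label_dominated k i : (1 <= i <= n)%N -> roman_label k i = 0%N ->
  (1 <= i.-1)%N && (roman_label k i.-1 == 2%N) ||
  (i < n)%N && (roman_label k i.+1 == 2%N).
Proof.
move=> iP; rewrite {1}/roman_label.
(* An end labelled 0 leaves two classes for [k]: that of its neighbour and that of the end itself,
   whose label 2 was moved to the neighbour. *)
have [-> k0|i1] := eqVneq i 1%N.
  by apply/orP; right; rewrite roman_label_eq2 //; lia.
have [-> kn|iN] := eqVneq i n.
  by apply/orP; left; rewrite roman_label_eq2 //; lia.
case: ifP => // /negbT/norP[ki /norP[]]; rewrite !negb_and => i2 iN1 _.
(* Three consecutive indices meet every class modulo 3; [i2] and [iN1] ensure that the neighbour in
   the class of [k] is not an end. *)
have [ks|kp] : (k %% 3 = i.+1 %% 3 \/ k %% 3 = i.-1 %% 3)%N by lia.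
  by apply/orP; right; rewrite roman_label_eq2 //; lia.
by apply/orP; left; rewrite roman_label_eq2 //; lia.
Qed.

Lemma sum_roman_label i : (1 <= i <= n)%N ->
  (roman_label 0 i + roman_label 1 i + roman_label 2 i <=
   if (i == 1) || (i == n) then 1 else 2 + 2 * (i == 2) + 2 * (i == n.-1))%N.
Proof.
move=> iP; rewrite /roman_label.
have [->|i1] := eqVneq i 1%N; first by [].
have [->|iN] := eqVneq i n.
  by have := ltn_pmod n.+1 (isT : 0 < 3)%N; case: (n.+1 %% 3)%N => [|[|[|]]].
have := ltn_pmod i (isT : 0 < 3)%N; have := ltn_pmod n (isT : 0 < 3)%N.
(* The tests on [i] are treated as independent; any overlap among them only lowers the left side, so
   an inequality survives this. *)
by case: (n %% 3)%N => [|[|[|]]] // _; case: (i %% 3)%N => [|[|[|]]] // _;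
  case: (i == 2%N); case: (i == n.-1).
Qed.

(** As all edges of the path are strong, domination by an adjacent index yields an SNRDF. *)
Lemma gamma_le_label (g : nat -> nat) : (forall i, g i < 3)%N ->
  (forall i, (1 <= i <= n)%N -> g i = 0%N ->
    (1 <= i.-1)%N && (g i.-1 == 2%N) || (i < n)%N && (g i.+1 == 2%N)) ->
  gamma_snR G <= \sum_(1 <= i < n.+1) (g i)%:R * b i.
Proof.
move=> g3 gdom; have [pos [posP posK]] := fuzzy_path_pos.
pose f := [ffun x => inord (g (pos x)) : 'I_3].
have -> : \sum_(1 <= i < n.+1) (g i)%:R * b i = weight G f.
  rewrite /weight fuzzy_path_sum; apply: eq_big_nat => i iP.
  by rewrite ffunE inordK // posK.
apply: bigmin_le_cond; apply/forallP => x; rewrite ffunE inordK //.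
have [xP xK] := posP x; apply/implyP => /eqP /gdom - /(_ xP) /orP[]/andP[iP gi].
  apply/existsP; exists (u (pos x).-1); rewrite inE ffunE inordK // posK ?gi ?andbT; last lia.
  apply: fuzzy_path_strong; rewrite /edge mu_sym.
  by have := @fuzzy_path_edge (pos x).-1; rewrite prednK ?xK; first apply; lia.
apply/existsP; exists (u (pos x).+1); rewrite inE ffunE inordK // posK ?gi ?andbT; last lia.
by apply: fuzzy_path_strong; rewrite -{1}xK fuzzy_path_edge //; lia.
Qed.

Lemma triple_gamma_le :
  3 * gamma_snR G <=
    b 1%N + b n + \sum_(1 <= i < n.-1) 2 * b i.+1 + 2 * b 2%N + 2 * b n.-1.
Proof.
have le_lab k : gamma_snR G <= \sum_(1 <= i < n.+1) (roman_label k i)%:R * b i.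
  by apply: gamma_le_label; [exact: roman_label_lt3|exact: roman_label_dominated].
have sum_ends (F : nat -> R) :
    \sum_(1 <= i < n.+1) F i = F 1%N + F n + \sum_(1 <= i < n.-1) F i.+1.
  rewrite big_nat_recr /=; last lia.
  have -> : \sum_(1 <= i < n) F i = F 1%N + \sum_(1 <= i < n.-1) F i.+1.
    by rewrite -big_nat_recl ?prednK //; lia.
  by rewrite addrAC.
(* The two extra terms become indicator sums, so that the comparison is termwise, even for [n = 3]
   where they share an index. *)
have pick_one (j : nat) : (1 <= j < n.-1)%N ->
    2 * b j.+1 = \sum_(1 <= i < n.-1) if i == j then 2 * b i.+1 else 0.
  by move=> jP; rewrite -big_mkcond big_nat1_eq jP.
have -> : 3 * gamma_snR G = gamma_snR G + gamma_snR G + gamma_snR G by lra.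
apply: (le_trans (lerD (lerD (le_lab 0%N) (le_lab 1%N)) (le_lab 2%N))).
rewrite -!big_split /=.
pose c i := if (i == 1%N) || (i == n) then 1%N
  else (2 + 2 * (i == 2) + 2 * (i == n.-1))%N.
apply: (@le_trans _ _ (\sum_(1 <= i < n.+1) (c i)%:R * b i)).
  rewrite !big_nat; apply: ler_sum => i iP.
  by rewrite -!mulrDl -!natrD ler_wpM2r ?mu_s_ge0 // ler_nat sum_roman_label.
have cn : c n = 1%N by rewrite /c eqxx orbT.
rewrite sum_ends cn !mul1r -!addrA !lerD2l.
rewrite (pick_one 1%N); last lia.
rewrite -[in X in _ + (_ + X)](@prednK n.-1) ?(pick_one n.-2); try lia.
rewrite -!big_split /= !big_nat; apply: ler_sum => i iP.
have b0 := mu_s_ge0 G (u i.+1).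
rewrite /c ifN ?eqSS; last lia.
have -> : (i.+1 == n.-1) = (i == n.-2) by lia.
by case: (i == 1%N); case: (i == n.-2) => /=; lra.
Qed.
End FuzzyPath.

Theorem theorem4p8 (R : realType) (V : finType) (G : fuzzyGraph R V)
    (n : nat) (u : nat -> V) (n_ge3 : (3 <= n)%N) (pathG : fuzzy_path G n u)
    (gammaG : gamma_snR G = 2 / 3 * (graph_size G + mu_min G + mu_max G)) :
  (exists l ls : nat,
     [/\ (1 <= l <= n.-1)%N, (1 <= ls <= n.-1)%N & (l <= ls)%N] /\
     mu_min G = mu G (u l) (u l.+1) /\
     mu_max G = mu G (u ls) (u ls.+1) /\
     nonincreasing_on (fun i => mu G (u i) (u i.+1)) 1 l /\
     nonincreasing_on (fun i => mu G (u i) (u i.+1)) ls n.-1 /\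
     nondecreasing_on (fun i => mu G (u i) (u i.+1)) l ls) /\
  [/\ mu_s G (u 1%N) = mu_max G, mu_s G (u 2%N) = mu_max G,
      mu_s G (u n.-1) = mu_max G & mu_s G (u n) = mu_max G].
Proof.
have [l lP minE] := fuzzy_path_mu_min pathG n_ge3.
have nE : n.-1.+1 = n by lia.
have le3 := triple_gamma_le pathG n_ge3.
have [||||ends [aN decr incr]] := @valley R (fun i => mu G (u i) (u i.+1))
    (fun i => mu_s G (u i)) n.-1 l (mu_max G).
- lia.
- lia.
- move=> i iP; have iP' : (1 <= i < n)%N by lia.
  have [? ?] := fuzzy_path_mu_s pathG iP'.
  by split=> //=; apply: (fuzzy_path_mu_max pathG).
- rewrite nE -(fuzzy_path_size pathG n_ge3) -minE; lra.
rewrite nE in ends; split; last exact: ends.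
exists l, n.-1; split; first by split; lia.
split=> //; split; first exact/esym.
split; first exact: decr.
split; last exact: incr.
(* With [ls] equal to [n.-1] this range is a single index. *)
by move=> i j li ij jn; have -> : j = i by lia.
Qed.
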